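(* Let $\mathcal{X}$ be a finite-dimensional real Hilbert space, $n\ge 1$, $L>0$, $\tau\in[0,L]$, and let $f_1,\dots,f_n:\mathcal{X}\to\mathbb{R}$ be $L$-smooth and $\tau$-weakly convex functions. Let $f=\frac1n\sum_{i=1}^n f_i$ and suppose that $f^\star=\inf f>-\infty$. Let $(x^t,g^t)_{t\ge0}$ be generated by the algorithm PAGE with probability $p\in(0,1]$, stepsize $$\gamma=\frac{\eta}{L\left(1+\sqrt{\frac{2\tau}{L+\tau}}\sqrt{\frac{1-p}{p}}\right)}$$ for some constant $\eta\in(0,1)$, and initial points $x^0,g^0\in\mathcal{X}$ such that $\|g^0\|^2\le C_0\|\nabla f(x^0)\|^2$ for some constant $C_0\ge0$ (for example, $g^0=0$). Let $\Delta_0=f(x^0)-f^\star$, $a=\frac12$, $b=\frac{\gamma(L-\tau)}{4-2\gamma(L-\tau)}$, and $$\Psi^0=\Delta_0-b\gamma\|\nabla f(x^0)\|^2+\frac{a\gamma}{p}\|g^0-\nabla f(x^0)\|^2+\frac{b\gamma}{p}\|g^0\|^2 .$$ For every $T\ge 0$, let $\tilde{x}^T=x^t$ with $t$ chosen uniformly at random in $\{0,\dots,T\}$ (independently of the algorithm). Then, for every $T\ge1$, $$\mathbb{E}\left[\|\nabla f(\tilde{x}^T)\|^2\right]=\mathcal{O}\left(\frac{\Psi^0}{T\gamma}\right)\qquad\text{and}\qquad \frac{\Psi^0}{T\gamma}=\mathcal{O}\left(\frac{\Delta_0L}{Tp}\right).$$ Consequently, if $p\ge\frac1n$, then for every $\epsilon>0$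 the complexity of PAGE to achieve $\mathbb{E}[\|\nabla f(\tilde{x}^T)\|^2]\le\epsilon$ is $\mathcal{O}(\Delta_0Ln\,\epsilon^{-1})$ gradient evaluations; that is, there is a $T\ge 0$ with $\mathbb{E}[\|\nabla f(\tilde{x}^T)\|^2]\le\epsilon$ such that the expected number $T(np+2(1-p))$ of gradient evaluations in $T$ iterations is $\mathcal{O}(\Delta_0Ln\,\epsilon^{-1})$.
   Context: A function $h:\mathcal{X}\to\mathbb{R}$ is $L$-smooth if it is differentiable on $\mathcal{X}$ and $\|\nabla h(x)-\nabla h(y)\|\le L\|x-y\|$ for all $x,y\in\mathcal{X}$. It is $\tau$-weakly convex if $h+\frac{\tau}{2}\|\cdot\|^2$ is convex. Algorithm PAGE. Inputs: (deterministic) $x^0,g^0\in\mathcal{X}$, stepsize $\gamma>0$, probability $p\in(0,1]$. For $t=0,1,2,\dots$: set $x^{t+1}=x^t-\gamma g^t$. Draw $\theta^t\in\{0,1\}$ with $\mathbb{P}(\theta^t=1)=p$, and $i^t$ uniformly at random in $\{1,\dots,n\}$. If $\theta^t=0$, set $g^{t+1}=g^t+\nabla f_{i^t}(x^{t+1})-\nabla f_{i^t}(x^t)$ (counted as 2 gradient evaluations); if $\theta^t=1$, set $g^{t+1}=\nabla f(x^{t+1})$ (counted as $n$ gradient evaluations). All the random variables $\theta^0,i^0,\theta^1,i^1,\dots$ are mutually independent. Each iteration thus requires $np+2(1-p)$ gradient evaluations on average; the choice of $g^0$ is not charged. Meaning of $\mathcal{O}$: hidden constants depend only on $\eta$ and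 $C_0$, not on $\mathcal{X},n,L,\tau,p,T,\epsilon$, the functions or the initial points. *)

(* Defs.v *)
From HB Require Import structures.
From mathcomp Require Import all_boot all_order all_algebra.
From mathcomp Require Import all_classical all_reals all_analysis.

Set Implicit Arguments.
Unset Strict Implicit.
Unset Printing Implicit Defensive.

Import Order.TTheory GRing.Theory Num.Theory numFieldNormedType.Exports.

Local Open Scope classical_set_scope.
Local Open Scope ring_scope.

(* Finite-dimensional real Hilbert spaces: completeness is automatic, and the
   norm (hence the topology used by [differentiable]) is the one induced by the
   inner product. *)
HB.mixin Record NormedVector_isEuclidean (R : realType) X
    of Vector R X & NormedModule R X := {
  inner : X -> X -> R ;
  inner_sym : forall x y, inner x y = inner y x ;
  inner_linearl : forall (a : R) x y z,
    inner (a *: x + y) z = a * inner x z + inner y z ;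
  inner_normE : forall x, inner x x = `|x| ^+ 2
}.

#[short(type="euclideanType")]
HB.structure Definition Euclidean (R : realType) :=
  {X of NormedVector_isEuclidean R X & Vector R X & NormedModule R X}.

Section smooth_functions.
Context {R : realType} {X : euclideanType R}.
Implicit Types (h : X -> R) (x y : X).

(* The Riesz representative of the Frechet derivative; it exists and is unique
   wherever h is differentiable, and the default value 0 is never used there. *)
Definition grad h x : X :=
  xget 0 [set g : X | forall v, 'd h x v = inner g v].

Definition smooth (L : R) h :=
  (forall x, differentiable h x) /\
  (forall x y, `|grad h x - grad h y| <= L * `|x - y|).

Definition weakly_convex (tau : R) h :=
  convex_function [set: convex_lmodType X]
    (fun x : X => h x + tau / 2 * `|x| ^+ 2).

Definition average n (f : 'I_n -> X -> R) : X -> R :=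
  fun x => n%:R^-1 * \sum_(i < n) f i x.

End smooth_functions.

Section page_algorithm.
Context {R : realType} {X : euclideanType R}.
Variables (n : nat) (f : 'I_n -> X -> R) (gamma : R) (x0 g0 : X).

Definition page_step (theta : bool) (i : 'I_n) (xg : X * X) : X * X :=
  let x' := xg.1 - gamma *: xg.2 in
  (x', if theta then grad (average f) x'
       else xg.2 + grad (f i) x' - grad (f i) xg.1).

(* The pair (x^t, g^t) for given realizations of the coins and of the indices *)
Fixpoint page (theta : nat -> bool) (i : nat -> 'I_n) (t : nat) : X * X :=
  if t is s.+1 then page_step (theta s) (i s) (page theta i s) else (x0, g0).

End page_algorithm.

Definition page_evals (n : nat) (theta : nat -> bool) (T : nat) : nat :=
  (\sum_(t < T) (if theta t then n else 2))%N.

HB.instance Definition _ (n : nat) := isPointed.Build 'I_n.+1 ord0.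

HB.instance Definition _ (n : nat) := @isMeasurable.Build default_measure_display
  'I_n.+1 discrete_measurable discrete_measurable0
  discrete_measurableC discrete_measurableU.

Section probability.
Context {d : measure_display} {Omega : measurableType d} {R : realType}.
Implicit Types P : probability Omega R.

Definition mutually_independent P (K : eqType) (F : K -> set (set Omega)) :=
  forall (s : seq K) (A : K -> set Omega), uniq s ->
    (forall k, k \in s -> F k (A k)) ->
    P (\big[setI/setT]_(k <- s) A k) = (\prod_(k <- s) P (A k))%E.

Definition independent P (F G : set (set Omega)) :=
  forall A B, F A -> G B -> P (A `&` B) = (P A * P B)%E.

Definition uniform P m (Y : {RV P >-> 'I_m.+1}) :=
  forall k : 'I_m.+1, P (Y @^-1` [set k]) = (m.+1%:R^-1)%:E.

Definition coins_indices P n (theta : nat -> {RV P >-> bool})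
    (i : nat -> {RV P >-> 'I_n.+1}) (k : nat + nat) : set (set Omega) :=
  match k with
  | inl t => g_sigma_algebra_preimage (theta t)
  | inr t => g_sigma_algebra_preimage (i t)
  end.

End probability.

(* Main.v *)
Require Import Defs.
From HB Require Import structures.
From mathcomp Require Import all_boot all_order all_algebra.
From mathcomp Require Import all_classical all_reals all_analysis.
From mathcomp Require Import measurable_realfun ring lra.

Import Order.TTheory GRing.Theory Num.Theory numFieldNormedType.Exports.

Local Open Scope classical_set_scope.
Local Open Scope ring_scope.

(* Let q = (1 - p) / p and u_i = grad f_i(x^{t+1}) - grad f_i(x^t).
   Cocoercivity of the gradient of f_i + tau/2 |.|^2 gives
     |u_i|^2 <= (L - tau) <u_i, x^{t+1} - x^t> + L tau |x^{t+1} - x^t|^2.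
   The inner product also appears in the expansion of |g^t + u_i|^2, and b is
   chosen such that adding the term b |g^t|^2 to the usual PAGE potential
   cancels it.  The remaining multiple of |g^t|^2 is nonpositive for the given
   stepsize, so that the potential decreases in mean by
   gamma (1/2 - b) |grad f(x^t)|^2 at each step, where 1/2 - b >= (1 - eta) / 2.
   Since the pairs (theta^t, i^t) are independent, the expectation of an
   observable of (x^t, g^t) is given by the t-th iterate of the one-step mean
   operator. *)

(** * Inner products: Cauchy-Schwarz and Riesz representation *)

Section inner_product.
Context {R : realType} {X : euclideanType R}.
Implicit Types x y z : X.

Lemma innerDl x y z : inner (x + y) z = inner x z + inner y z.
Proof. by rewrite -[x in LHS]scale1r inner_linearl mul1r. Qed.

Lemma inner0l z : inner 0 z = 0.
Proof. by have := innerDl 0 0 z; rewrite addr0; lra. Qed.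

Lemma innerZl (a : R) x z : inner (a *: x) z = a * inner x z.
Proof. by rewrite -[a *: x]addr0 inner_linearl inner0l addr0. Qed.

Lemma innerNl x z : inner (- x) z = - inner x z.
Proof. by rewrite -scaleN1r innerZl mulN1r. Qed.

Lemma innerDr x y z : inner z (x + y) = inner z x + inner z y.
Proof. by rewrite !(inner_sym z) innerDl. Qed.

Lemma innerZr (a : R) x z : inner z (a *: x) = a * inner z x.
Proof. by rewrite !(inner_sym z) innerZl. Qed.

Lemma innerNr x z : inner z (- x) = - inner z x.
Proof. by rewrite !(inner_sym z) innerNl. Qed.

Definition innerE := (innerDl, innerDr, innerNl, innerNr, innerZl, innerZr).

Lemma inner_suml n (u : 'I_n -> X) z :
  inner (\sum_(i < n) u i) z = \sum_(i < n) inner (u i) z.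
Proof.
elim/big_rec2: _ => [|i r s _ <-]; first by rewrite inner0l.
by rewrite innerDl.
Qed.

Lemma inner_ge0 x : 0 <= inner x x.
Proof. by rewrite inner_normE sqr_ge0. Qed.

Lemma inner_eq0 x : inner x x = 0 -> x = 0.
Proof. by rewrite inner_normE => /eqP; rewrite sqrf_eq0 normr_eq0 => /eqP. Qed.

Lemma inner_inj x y : (forall v, inner x v = inner y v) -> x = y.
Proof.
move=> xy; apply/eqP; rewrite -subr_eq0; apply/eqP/inner_eq0.
by rewrite innerDl innerNl xy subrr.
Qed.

(** Cauchy-Schwarz: expand the square of |y| x - |x| y, which is nonnegative, and divide by |x|
    |y|. *)
Lemma inner_le_norm x y : inner x y <= `|x| * `|y|.
Proof.
have [->|x0] := eqVneq x 0; first by rewrite inner0l normr0 mul0r.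
have [->|y0] := eqVneq y 0; first by rewrite inner_sym inner0l normr0 mulr0.
have nx : 0 < `|x| by rewrite normr_gt0.
have ny : 0 < `|y| by rewrite normr_gt0.
have := inner_ge0 (`|y| *: x - `|x| *: y).
rewrite !innerE (inner_sym y x) !inner_normE => h.
have xy : 0 < `|x| * `|y| by rewrite mulr_gt0.
rewrite -(ler_pM2l xy); nra.
Qed.

(** The map [Phi], sending a vector to its inner products with a basis, is injective, hence onto by
    dimension; a preimage of the values of [l] on that basis represents [l]. *)
Lemma riesz (l : {linear X -> R^o}) : exists g, forall v, l v = inner g v.
Proof.
pose e := vbasis {:X}.
pose Phi (v : X) : 'rV[R]_(dim X) := \row_i inner v e`_i.
have Phi_linear : linear Phi.
  by move=> a u v; apply/rowP => j; rewrite !mxE innerDl innerZl.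
pose PhiL := HB.pack_for {linear X -> 'rV[R]_(dim X)} Phi
  (GRing.isLinear.Build _ _ _ _ _ Phi_linear).
pose F : 'Hom(X, 'rV[R]_(dim X)) := linfun PhiL.
have basisE v : v = \sum_(i < \dim {:X}) coord e i v *: e`_i.
  by rewrite -coord_vbasis ?memvf.
have FE v : F v = Phi v by rewrite lfunE.
have dimE : \dim {:X} = dim X by rewrite dimvf.
have kerF : lker F == 0%VS.
  apply/lker0P => u v; rewrite !FE => uv.
  apply: inner_inj => w; rewrite !(inner_sym _ w) (basisE w) !inner_suml.
  apply: eq_bigr => i _; rewrite !innerZl !(inner_sym e`_i).
  have := congr1 (fun r : 'rV_ _ => r 0 (cast_ord dimE i)) uv.
  by rewrite !mxE /= => ->.
have imF : limg F = fullv.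
  apply/eqP; rewrite eqEdim subvf limg_dim_eq ?(eqP kerF) ?capv0//.
  by rewrite !dimvf dim_matrix mul1r /=.
have /memv_imgP[g _ gE] : \row_(i < dim X) l e`_i \in limg F.
  by rewrite imF memvf.
exists g => v; rewrite (basisE v) linear_sum inner_sym inner_suml.
apply: eq_bigr => i _; rewrite linearZ innerZl inner_sym; congr (_ * _).
have := congr1 (fun r : 'rV_ _ => r 0 (cast_ord dimE i)) gE.
by rewrite FE !mxE.
Qed.

End inner_product.

(** * Gradients, the descent lemma and weak convexity to first order *)

Section gradient.
Context {R : realType} {X : euclideanType R}.
Implicit Types (h : X -> R) (x y v : X).

Lemma gradE h x v : differentiable h x -> 'd h x v = inner (grad h x) v.
Proof.
move=> dh; rewrite /grad; case: xgetP => [g _ ->//|].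
by have [g gE] := riesz ('d h x : {linear X -> R^o}) => /(_ g).
Qed.

Lemma grad_unique h x g :
  differentiable h x -> (forall v, 'd h x v = inner g v) -> grad h x = g.
Proof. by move=> dh gE; apply: inner_inj => v; rewrite -gradE. Qed.

Lemma averageE n (f : 'I_n -> X -> R) :
  average f = n%:R^-1 *: \sum_(i < n) f i.
Proof. by apply/funext => y; rewrite /= fct_sumE. Qed.

Lemma average_differentiable n (f : 'I_n -> X -> R) x :
  (forall k, differentiable (f k) x) -> differentiable (average f) x.
Proof.
move=> df; rewrite averageE.
by apply: differentiableZ; apply: differentiable_sum.
Qed.

Lemma grad_average n (f : 'I_n -> X -> R) x :
  (forall k, differentiable (f k) x) ->
  grad (average f) x = n%:R^-1 *: \sum_(i < n) grad (f i) x.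
Proof.
move=> df; apply: grad_unique; first exact: average_differentiable.
move=> v; rewrite innerZl inner_suml.
rewrite averageE -deriveE; last first.
  by apply: differentiableZ; apply: differentiable_sum.
rewrite deriveZ; last by apply/diff_derivable/differentiable_sum.
rewrite derive_sum; last by move=> k; exact: diff_derivable.
by congr (_ * _); apply: eq_bigr => k _; rewrite deriveE// gradE.
Qed.

Lemma is_derive_line h x v (s : R) :
  differentiable h (x + s *: v) ->
  is_derive s (1 : R) (fun r : R => h (x + r *: v))
    (inner (grad h (x + s *: v)) v).
Proof.
move=> dh; rewrite -gradE//.
have dl : is_diff s (cst x + ( *:%R^~ v) : R -> X) (0 + ( *:%R^~ v)).
  exact: is_diffD.
have dc : differentiable (h \o (cst x + ( *:%R^~ v) : R -> X)) s.
  by apply: differentiable_comp.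
apply: DeriveDef; first exact: diff_derivable.
by rewrite deriveE// diff_comp//= diff_val /= add0r scale1r.
Qed.

(** The sign [e] covers the upper and the lower quadratic bound at once. The mean value theorem on
    [0, 1] is applied to [psi], whose derivative is nonpositive there by the Lipschitz bound. *)
Lemma smooth_descent (L : R) h x v (e : R) : `|e| = 1 -> smooth L h ->
  e * (h (x + v) - h x - inner (grad h x) v) <= L / 2 * `|v| ^+ 2.
Proof.
move=> e1 [dh Lh].
pose psi s := e * h (x + s *: v)
  - (s * (e * inner (grad h x) v) + L / 2 * `|v| ^+ 2 * s ^+ 2).
pose dpsi s := e * inner (grad h (x + s *: v) - grad h x) v - L * `|v| ^+ 2 * s.
have psiE : psi = (e \*: (fun s => h (x + s *: v)))
    - ((e * inner (grad h x) v) \*: id + (L / 2 * `|v| ^+ 2) \*: (id ^+ 2)).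
  apply/funext => s; rewrite /psi !fctE /= /GRing.scale /=; ring.
have dpsiE (s : R) : is_derive s (1 : R) psi (dpsi s).
  rewrite psiE; have := @is_derive_line h x v s (dh _).
  move=> dl; apply: is_derive_eq.
  rewrite /dpsi; move: (grad h x) (grad h (x + s *: v)) => gx g.
  by rewrite innerDl innerNl /GRing.scale /=; field.
have [] := @MVT R psi dpsi 0 1 ltr01 => //.
  apply: derivable_within_continuous => s _.
  by have [] := dpsiE s.
move=> c; rewrite in_itv /= => /andP[c0 c1].
have : inner (e *: (grad h (x + c *: v) - grad h x)) v <= L * c * `|v| ^+ 2.
  apply: (le_trans (inner_le_norm _ _)).
  rewrite normrZ e1 mul1r expr2 mulrA ler_wpM2r// -mulrA.
  apply: (le_trans (Lh _ _)).
  by rewrite addrC addKr normrZ gtr0_norm.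
rewrite /psi /dpsi scale1r scale0r addr0 innerZl; lra.
Qed.

(** If the inequality failed by [del > 0], convexity on the segment from [x] to [x + v] would put
    h(x + s v) at least s [del] below the tangent at [x], whereas smoothness only allows a gap of
    order s^2. *)
Lemma weakly_convex_ge (L tau : R) h x v : 0 <= L -> 0 <= tau -> smooth L h ->
  weakly_convex tau h ->
  h x + inner (grad h x) v - tau / 2 * `|v| ^+ 2 <= h (x + v).
Proof.
move=> L0 tau0 sh wc; rewrite leNgt; apply/negP.
set B := h (x + v); set D := inner (grad h x) v => lt_B.
(* The summand 1 keeps [N] positive when [v = 0]. Since [s * N <= del], the quadratic gap divided by
   [s] stays below [del / 2]. *)
pose N := L * `|v| ^+ 2 + 1; pose del := h x + D - tau / 2 * `|v| ^+ 2 - B.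
have N1 : 1 <= N by rewrite lerDr mulr_ge0// sqr_ge0.
have del0 : 0 < del by rewrite /del; lra.
pose s := Num.min 1 (del / N).
have s0 : 0 < s by rewrite lt_min ltr01 divr_gt0//; lra.
have s1 : s <= 1 by rewrite ge_min lexx.
have sN : s * N <= del by rewrite -ler_pdivlMr ?ge_min ?lexx ?orbT//; lra.
have s01 : 0 <= s <= 1 by rewrite (ltW s0).
have /= := @smooth_descent L h x (s *: v) (-1) (normrN1 _) sh.
rewrite innerZr -/D normrZ gtr0_norm//.
have := wc (Itv01 (ltW s0) s1) (x + v) x (in_setT _) (in_setT _).
have -> : conv (Itv01 (ltW s0) s1) (x + v : convex_lmodType X) x
    = x + s *: v :> X.
  rewrite /conv /= scalerDr /unstable.onem scalerBl scale1r.
  by rewrite addrC addrA subrK.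
rewrite convRE /= /unstable.onem -/B exprMn -!(inner_normE (_ + _)) !innerE.
rewrite (inner_sym v x) !inner_normE.
set vv := `|v| ^+ 2; set xx := `|x| ^+ 2; set hs := h (x + _) => wcs dsc.
have vv0 : 0 <= vv by exact: sqr_ge0.
have : s * del <= s * (s * (L / 2 * vv) - s * (tau / 2 * vv)).
  have -> : del = h x + D - tau / 2 * vv - B by [].
  by move: (inner x v) wcs dsc => xv; clearbody B D vv xx hs s; lra.
rewrite ler_pM2l//.
have : 0 <= s * (tau / 2 * vv) by rewrite !mulr_ge0// ltW.
have : s * (L / 2 * vv) = (s * N - s) / 2 by rewrite /N -/vv; field.
lra.
Qed.

End gradient.

(** * Cocoercivity and gradient bounds *)

Section cocoercivity.
Context {R : realType} {X : euclideanType R}.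
Implicit Types (h : X -> R) (x y v : X).

(* Cocoercivity of the gradient of the convex, [L + tau]-smooth function
   [h + tau / 2 * `|_| ^+ 2], expressed in terms of [grad h]. *)
Lemma smooth_weakly_convex_grad (L tau : R) h x y : 0 < L -> 0 <= tau ->
  smooth L h -> weakly_convex tau h ->
  `|grad h y - grad h x| ^+ 2
    <= (L - tau) * inner (grad h y - grad h x) (y - x)
       + L * tau * `|y - x| ^+ 2.
Proof.
move=> L0 tau0 sh wc.
have Mu : L + tau != 0 by apply: lt0r_neq0; lra.
(* Two bounds are compared at the point b - c w, where w is the change from [a] to [b] of the
   gradient of h + tau/2 |.|^2 and c = 1 / (L + tau): weak convexity at [a] from below, descent at
   [b] from above. *)
have half a b : h a + inner (grad h a) (b - a) - tau / 2 * `|b - a| ^+ 2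
    + `|grad h b - grad h a + tau *: (b - a)| ^+ 2 / (2 * (L + tau)) <= h b.
  have [c cE] : exists c, c = (L + tau)^-1 by eexists.
  have cM : c * (L + tau) = 1 by rewrite cE mulVf.
  have -> : (2 * (L + tau))^-1 = c / 2 by rewrite cE invfM mulrC.
  have desc w := smooth_descent _ _ b (- c *: w) _ (normr1 _) sh.
  have wcge w :=
    weakly_convex_ge _ _ _ a (b - a - c *: w) (ltW L0) tau0 sh wc.
  move: (grad h a) (grad h b) desc wcge => ga gb.
  have zE w : a + (b - a - c *: w) = b + - c *: w.
    by rewrite scaleNr addrA addrCA subrr addr0.
  move: (b - a) zE => v zE.
  have [w wE] : exists w, w = gb - ga + tau *: v by eexists.
  move=> /(_ w) + /(_ w); rewrite zE -wE.
  have wwE : `|w| ^+ 2 = inner gb w - inner ga w + tau * inner v w.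
    by rewrite -inner_normE {1}wE !innerE.
  have -> : `|v - c *: w| ^+ 2
      = `|v| ^+ 2 - 2 * c * inner v w + c ^+ 2 * `|w| ^+ 2.
    by rewrite -!inner_normE !innerE (inner_sym w v); ring.
  have -> : `|- c *: w| ^+ 2 = c ^+ 2 * `|w| ^+ 2.
    by rewrite -!inner_normE !innerE; ring.
  rewrite innerDr innerNr !innerZr.
  move: (inner v w) (inner ga v) (inner ga w) (inner gb w)
    (`|w| ^+ 2) (`|v| ^+ 2) wwE => vw av aw bw ww vv wwE.
  move: (h (b + _)) (h a) (h b) => hz ha hb h1 h2.
  have : c * ww = c * bw - c * aw + tau * (c * vw) by rewrite wwE; ring.
  have : c * c * (L + tau) * ww = c * ww by rewrite -(mulrA c c) cM mulr1.
  lra.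
(* Exchanging the two points cancels the values of [h]; multiplying by [L + tau] and expanding the
   square then gives the claim. *)
have := lerD (half x y) (half y x).
move: {half} (grad h x) (grad h y) (h x) (h y) => gx gy hx hy.
have [v vE] : exists v, v = y - x by eexists.
have [u uE] : exists u, u = gy - gx by eexists.
rewrite -(opprB y x) -(opprB gy gx) -vE -uE normrN innerNr.
rewrite scalerN -opprD normrN.
have -> : inner gx v = inner gy v - inner u v.
  by rewrite uE innerDl innerNl; ring.
have -> : `|u + tau *: v| ^+ 2
    = `|u| ^+ 2 + 2 * tau * inner u v + tau ^+ 2 * `|v| ^+ 2.
  rewrite -!inner_normE !innerDl !innerDr !innerZl !innerZr (inner_sym v u).
  by ring.
move: (inner u v) (inner _ v) (`|u| ^+ 2) (`|v| ^+ 2) => uv gv uu vv.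
rewrite invfM; have MV : (L + tau) * (L + tau)^-1 = 1 by rewrite divff.
move: (L + tau)^-1 MV => c cM h1.
have : (L + tau) * (- uv - tau * vv
    + (uu + 2 * tau * uv + tau ^+ 2 * vv) * c) <= 0.
  by rewrite pmulr_rle0; lra.
rewrite mulrDr [X in _ + X]mulrCA cM mulr1.
lra.
Qed.

(** A gradient step of length 1/L lowers [h] by at least |grad h x|^2 / (2 L), and [h] stays above
    [m]. The upper quadratic bound is the hypothesis because that is the form available for the
    average. *)
Lemma smooth_grad_le (L : R) h x m : 0 < L ->
  (forall v, h (x + v) - h x - inner (grad h x) v <= L / 2 * `|v| ^+ 2) ->
  (forall y, m <= h y) ->
  `|grad h x| ^+ 2 <= 2 * L * (h x - m).
Proof.
move=> L0 sh hm.
have := sh (- L^-1 *: grad h x); have := hm (x + - L^-1 *: grad h x).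
move: {sh hm} (grad h x) (h x) (h (x + _)) => g hx hz hzm.
have LV : L * L^-1 = 1 by rewrite divff// gt_eqF.
rewrite innerZr inner_normE normrZ exprMn normrN real_normK ?num_real//.
move: (L^-1) (`|_| ^+ 2) LV => c uu cL h1.
have e1 : L * (c * uu) = uu by rewrite mulrA cL mul1r.
have e2 : L * (L * (c ^+ 2 * uu)) = uu.
  by rewrite mulrA -expr2 mulrA -exprMn cL expr1n mul1r.
have : L * (hz - hx - - c * uu) <= L * (L / 2 * (c ^+ 2 * uu)).
  by rewrite ler_pM2l.
have : L * m <= L * hz by rewrite ler_pM2l.
lra.
Qed.

End cocoercivity.

(** * One-step decrease of the potential *)

Section page_descent.
Context {R : realType} {X : euclideanType R} (m : nat).
Variables (f : 'I_m.+1 -> X -> R) (L tau p gamma : R).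
Let n := m.+1.
Let favg := average f.
Let fstar := inf (range favg).
Let b := gamma * (L - tau) / (4 - 2 * gamma * (L - tau)).

(* One step of the Markov chain [(x^t, g^t)], acting on observables. *)
Definition page_mean (F : X * X -> R) (xg : X * X) : R :=
  n%:R^-1 * \sum_(i < n) (p * F (page_step f gamma true i xg)
                          + (1 - p) * F (page_step f gamma false i xg)).

Lemma page_mean_le F G xg : 0 <= p <= 1 -> (forall y, F y <= G y) ->
  page_mean F xg <= page_mean G xg.
Proof.
move=> /andP[p0 p1] FG; rewrite ler_wpM2l ?invr_ge0//.
by apply: ler_sum => i _; rewrite lerD// ler_wpM2l// subr_ge0.
Qed.

Lemma page_mean_sum (I : Type) (r : seq I) (F : I -> X * X -> R) xg :
  page_mean (fun y => \sum_(t <- r) F t y) xg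
    = \sum_(t <- r) page_mean (F t) xg.
Proof.
rewrite /page_mean -mulr_sumr exchange_big /=; congr (_ * _).
by apply: eq_bigr => i _; rewrite !mulr_sumr -big_split.
Qed.

Lemma page_meanZ c F xg :
  page_mean (fun y => c * F y) xg = c * page_mean F xg.
Proof.
rewrite /page_mean mulrCA; congr (_ * _); rewrite mulr_sumr.
by apply: eq_bigr => i _; rewrite mulrDr ![c * (_ * _)]mulrCA.
Qed.

(** Telescoping by induction on [N] with a free starting point: the first step is split off, and
    monotonicity of [page_mean] brings in the induction hypothesis at the state reached after it. *)
Lemma iter_page_mean_sum_le (c : R) (G V : X * X -> R) N xg : 0 <= p <= 1 ->
  (forall y, 0 <= V y) -> (forall y, page_mean V y <= V y - c * G y) ->
  c * (\sum_(t < N) iter t page_mean G xg) <= V xg.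
Proof.
move=> p01 V0 KV; elim: N xg => [|N IH] xg; first by rewrite big_ord0 mulr0.
rewrite big_ord_recl /= mulrDr.
have -> : \sum_(t < N) page_mean (iter t page_mean G) xg
    = page_mean (fun y => \sum_(t < N) iter t page_mean G y) xg.
  by rewrite page_mean_sum.
rewrite -page_meanZ -lerBrDl; apply: le_trans (KV xg).
exact: page_mean_le.
Qed.

Hypotheses (L0 : 0 < L) (tau0 : 0 <= tau) (tauL : tau <= L).
Hypotheses (p0 : 0 < p) (p1 : p <= 1) (gamma0 : 0 < gamma).
Hypotheses (fL : forall k, smooth L (f k)).
Hypotheses (ftau : forall k, weakly_convex tau (f k)).
Hypotheses (f_lb : has_lbound (range favg)).

Lemma average_descent x v :
  favg (x + v) - favg x - inner (grad favg x) v <= L / 2 * `|v| ^+ 2.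
Proof.
rewrite grad_average => [|k]; last by have [] := fL k.
rewrite innerZl inner_suml /favg /average -!mulrBr -!sumrB.
rewrite mulrC ler_pdivrMr ?ltr0n// mulrC.
have -> : n%:R * (L / 2 * `|v| ^+ 2) = \sum_(k < n) L / 2 * `|v| ^+ 2.
  by rewrite sumr_const card_ord mulr_natl.
apply: ler_sum => k _.
by have := smooth_descent _ _ x v 1 (normr1 _) (fL k); rewrite mul1r.
Qed.

Lemma average_grad_le x :
  `|grad favg x| ^+ 2 <= 2 * L * (favg x - fstar).
Proof.
apply: smooth_grad_le => // [v|y]; first exact: average_descent.
by apply: ge_inf => //; exists y.
Qed.

(** In the expanded squares, the cross term sees the [u i] only through their mean. The descent step
    uses this twice, with [w] equal to g - grad f(x') and to g. *)
Lemma average_normD (u : 'I_n -> X) (w ubar : X) :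
  ubar = n%:R^-1 *: \sum_(i < n) u i ->
  n%:R^-1 * \sum_(i < n) `|w + u i| ^+ 2
    = `|w| ^+ 2 + 2 * inner w ubar + n%:R^-1 * \sum_(i < n) `|u i| ^+ 2.
Proof.
move=> ->; rewrite innerZr inner_sym inner_suml.
have -> : \sum_(i < n) `|w + u i| ^+ 2 = n%:R * `|w| ^+ 2
    + 2 * \sum_(i < n) inner (u i) w + \sum_(i < n) `|u i| ^+ 2.
  have -> : n%:R * `|w| ^+ 2 = \sum_(i < n) `|w| ^+ 2.
    by rewrite sumr_const card_ord mulr_natl.
  rewrite mulr_sumr -!big_split /=.
  apply: eq_bigr => i _; rewrite -!inner_normE !innerDl !innerDr.
  by rewrite (inner_sym w); ring.
by rewrite !mulrDr mulKf ?pnatr_eq0// mulrCA.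
Qed.

(** At [(x0, g0)] its value is [Psi0]. The negative gradient term offsets what a reset of the
    estimator contributes on average to the last term. *)
Definition page_lyapunov (xg : X * X) : R :=
  favg xg.1 - fstar - b * gamma * `|grad favg xg.1| ^+ 2
  + 1 / 2 * gamma / p * `|xg.2 - grad favg xg.1| ^+ 2
  + b * gamma / p * `|xg.2| ^+ 2.

Hypothesis gamma_lt : gamma * (L - tau) < 2.
Hypothesis gamma_le : (1 - p) / p * L * tau * gamma ^+ 2
  <= 1 - L * gamma + L * gamma * (gamma * (L - tau)) / 2.

Lemma mean_affine (c0 c1 c2 : R) (F H : 'I_n -> R) :
  n%:R^-1 * \sum_(i < n) (c0 + c1 * F i + c2 * H i)
    = c0 + c1 * (n%:R^-1 * \sum_(i < n) F i)
      + c2 * (n%:R^-1 * \sum_(i < n) H i).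
Proof.
rewrite !big_split /= -!mulr_sumr sumr_const card_ord -(mulr_natl c0).
by rewrite !mulrDr mulKf ?pnatr_eq0// !(mulrCA n%:R^-1).
Qed.

Lemma page_lyapunov_descent xg : page_mean page_lyapunov xg
  <= page_lyapunov xg - gamma * (1 / 2 - b) * `|grad favg xg.1| ^+ 2.
Proof.
case: xg => x g; rewrite /page_mean /page_step /page_lyapunov /=.
pose a : R := 1 / 2.
have := average_descent x (- (gamma *: g)).
have uE : grad favg (x - gamma *: g) - grad favg x
    = n%:R^-1 *: \sum_(i < n) (grad (f i) (x - gamma *: g) - grad (f i) x).
  rewrite !grad_average => [|k|k]; try by have [] := fL k.
  by rewrite -scalerBr sumrB.
pose u i := grad (f i) (x - gamma *: g) - grad (f i) x.
have u2 k : `|u k| ^+ 2 <= (L - tau) * inner (u k) (- (gamma *: g))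
    + L * tau * `|- (gamma *: g)| ^+ 2.
  have := smooth_weakly_convex_grad _ _ _ x (x - gamma *: g)
    L0 tau0 (fL k) (ftau k).
  by rewrite (_ : x - gamma *: g - x = - (gamma *: g))// addrAC subrr add0r.
have udef i : grad (f i) (x - gamma *: g) - grad (f i) x = u i by [].
rewrite (eq_bigr _ (fun i _ => udef i)) in uE.
move: (grad favg (x - gamma *: g)) (grad favg x) (favg x)
  (favg (x - gamma *: g)) uE => G' G D D' uE.
have q0 : 0 <= (1 - p) / p by rewrite divr_ge0// ?subr_ge0// ltW.
(* A reset makes the error term vanish and contributes b gamma |G'|^2 on average through the last
   term, which cancels the negative term. Apart from the function value, only the branch without
   reset remains, with factor (1 - p) / p. *)
rewrite [X in _ -> n%:R^-1 * X <= _](eq_bigr (fun i => (D' - fstar)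
  + (1 - p) / p * gamma * a * `|g - G' + u i| ^+ 2
  + (1 - p) / p * gamma * b * `|g + u i| ^+ 2)); last first.
  move=> i _; rewrite -(addrA g) udef subrr normr0 (addrAC g) /a.
  by field; rewrite gt_eqF.
clearbody u.
have {u2} : n%:R^-1 * \sum_(i < n) `|u i| ^+ 2
    <= (L - tau) * inner (G' - G) (- (gamma *: g))
       + L * tau * `|- (gamma *: g)| ^+ 2.
  rewrite uE innerZl inner_suml mulrCA.
  have -> : L * tau * `|- (gamma *: g)| ^+ 2 = n%:R^-1
      * \sum_(i < n) L * tau * `|- (gamma *: g)| ^+ 2.
    by rewrite sumr_const card_ord -(mulr_natl (L * tau * _)) mulKf ?pnatr_eq0.
  rewrite -mulrDr ler_wpM2l ?invr_ge0// mulr_sumr -big_split /=.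
  exact: ler_sum.
rewrite mean_affine !(average_normD _ _ _ uE).
have [B BE] : exists B, B = (2 - gamma * (L - tau))^-1 by eexists.
have B0 : 0 < B by rewrite BE invr_gt0 subr_gt0.
have B1 : B * (2 - gamma * (L - tau)) = 1.
  by rewrite BE mulVf// subr_eq0 gt_eqF.
(* Hence a + b = B, so that the mean of |u_i|^2 enters with the factor gamma B (1 - p) / p. *)
have bE : b = B - 1 / 2.
  have D0 : 2 - gamma * (L - tau) != 0 by rewrite gt_eqF// subr_gt0.
  rewrite /b BE (_ : 4 - _ = 2 * (2 - gamma * (L - tau))); last by ring.
  by field.
(* This is [gamma_le] multiplied by [B]; it controls all remaining multiples of |g|^2. *)
have gB : (1 - p) / p * L * tau * gamma ^+ 2 * B <= B - L * gamma / 2.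
  have := ler_wpM2r (ltW B0) gamma_le; move=> /le_trans; apply.
  rewrite [leLHS](_ : _ = B - L * gamma / 2
    * (B * (2 - gamma * (L - tau)))); last by field.
  by rewrite B1 mulr1.
have [q qE] : exists q, q = (1 - p) / p by eexists.
have pV : p^-1 = q + 1 by rewrite qE; field; rewrite gt_eqF.
rewrite bE -qE pV /a {bE BE a uE udef}.
rewrite -{}qE in q0 gB.
move: (n%:R^-1 * _ : R) => U h2 h1.
(* Once the cross terms are combined, the slack is a nonnegative multiple of this square. *)
have := sqr_ge0 `|G - G'|.
have -> : `|G - G'| ^+ 2 = `|G| ^+ 2 - 2 * inner G G' + `|G'| ^+ 2.
  rewrite -!inner_normE !innerDl !innerDr !innerNl !innerNr (inner_sym G').
  by ring.
move: h1 h2.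
have -> : `|g - G'| ^+ 2 = `|g| ^+ 2 - 2 * inner g G' + `|G'| ^+ 2.
  rewrite -!inner_normE !innerDl !innerDr !innerNl !innerNr (inner_sym G').
  by ring.
have -> : `|g - G| ^+ 2 = `|g| ^+ 2 - 2 * inner g G + `|G| ^+ 2.
  rewrite -!inner_normE !innerDl !innerDr !innerNl !innerNr (inner_sym G).
  by ring.
rewrite normrN normrZ exprMn real_normK ?num_real// innerNr.
rewrite !innerNr !innerZr !innerDl !innerDr !innerNl !innerNr !inner_normE.
rewrite (inner_sym G g) (inner_sym G' G) (inner_sym G' g).
move: (inner g G) (inner g G') (inner G G') (`|g| ^+ 2 : R) (`|G| ^+ 2 : R)
  (`|G'| ^+ 2 : R) (sqr_ge0 `|g|) => gG gG' GG' N M M' N0 h1 h2 uu0.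
have := mulr_ge0 (mulr_ge0 q0 (ltW gamma0)) uu0.
have c0 : 0 <= q * gamma * B by rewrite !mulr_ge0// ltW.
have := ler_wpM2l c0 h2.
have := ler_wpM2l (mulr_ge0 (ltW gamma0) N0) gB.
(* The products of g with G' - G, including the one from cocoercivity, combine with a factor B (2 -
   gamma (L - tau)), which is 1. *)
have : q * gamma * (gG' - gG) * (B * (2 - gamma * (L - tau)))
  = q * gamma * (gG' - gG) by rewrite B1 mulr1.
move: h1; lra.
Qed.

(** Only the term with -b can be negative: by b <= 1/2 and [average_grad_le] it is at least -L gamma
    times the gap to [fstar], and L gamma <= 1. *)
Lemma page_lyapunov_ge0 xg : L * gamma <= 1 -> 0 <= b <= 1 / 2 ->
  0 <= page_lyapunov xg.
Proof.
move=> Lg /andP[b0 b1]; rewrite /page_lyapunov.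
move: b b0 b1 => c c0 c1.
apply: addr_ge0; last first.
  by rewrite !mulr_ge0 ?invr_ge0 ?sqr_ge0// ltW.
apply: addr_ge0; last first.
  by rewrite !mulr_ge0 ?invr_ge0 ?sqr_ge0// ltW.
have := average_grad_le xg.1.
move: (`|grad _ _| ^+ 2 : R) (sqr_ge0 `|grad favg xg.1|) (favg _) => G G0 D h.
have : c * gamma * G <= 1 / 2 * gamma * G by rewrite !ler_wpM2r// ltW.
have : gamma * G <= gamma * (2 * L * (D - fstar)) by rewrite ler_wpM2l// ltW.
have D0 : 0 <= D - fstar.
  rewrite -(pmulr_rge0 _ (_ : 0 < 2 * L)) ?mulr_gt0//.
  exact: le_trans h.
have := ler_wpM2r D0 Lg.
lra.
Qed.

End page_descent.

(** * Integration over finite partitions *)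

Section finite_partition.
Context {d : measure_display} {T : measurableType d} {R : realType}.
Variables (mu : {measure set T -> \bar R}) (I : finType) (Y : T -> I).
Hypothesis mY : forall y, measurable (Y @^-1` [set y]).
Variables (D : set T) (mD : measurable D).

Let part y := D `&` Y @^-1` [set y].

Let partE : D = \big[setU/set0]_(y : I) part y.
Proof.
rewrite -bigcup_seq; apply/seteqP; split => [x Dx|x [y _ []]//].
by exists (Y x) => //=; rewrite mem_index_enum.
Qed.

(** Measurability is checked piece by piece because the trajectory is constant once finitely many
    draws are fixed, while [grad] is not assumed to be measurable. *)
Lemma measurable_fun_finpartition (f : T -> R) :
  (forall y, measurable_fun (D `&` Y @^-1` [set y]) f) -> measurable_fun D f.
Proof.
move=> mf _ B mB.
have -> : D `&` f @^-1` B = \bigcup_(y in [set: I]) (part y `&` f @^-1` B).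
  apply/seteqP; split => [x [Dx fx]|x [y _ [[Dx _] fx]]]//.
  by exists (Y x).
apply: fin_bigcup_measurable => // y _.
by apply: mf => //; exact: measurableI.
Qed.

Lemma ge0_integral_finpartition (f : T -> R) : (forall x, 0 <= f x) ->
  (forall y, measurable_fun (D `&` Y @^-1` [set y]) f) ->
  (\int[mu]_(x in D) (f x)%:E
    = \sum_(y : I) \int[mu]_(x in D `&` Y @^-1` [set y]) (f x)%:E)%E.
Proof.
move=> f0 mf; rewrite [in LHS]partE ge0_integral_bigsetU//.
- by move=> y; exact: measurableI.
- exact: index_enum_uniq.
- by move=> y z _ _ [x [[_ <-] [_ <-]]].
- by rewrite -partE; apply/measurable_EFinP/measurable_fun_finpartition.
- by move=> x _; rewrite lee_fin.
Qed.

End finite_partition.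

Lemma eq_page {R : realType} {X : euclideanType R} (n : nat)
    (f : 'I_n -> X -> R) gamma x0 g0 (theta theta' : nat -> bool)
    (i i' : nat -> 'I_n) t :
  (forall s, (s < t)%N -> theta s = theta' s /\ i s = i' s) ->
  page f gamma x0 g0 theta i t = page f gamma x0 g0 theta' i' t.
Proof.
elim: t => //= t IH h; have [-> ->] := h t (leqnn _).
by rewrite IH// => s st; apply: h; rewrite ltnS ltnW.
Qed.

(** * Laws of single draws and the expected cost *)

Section coin.
Context {d : measure_display} {Omega : measurableType d} {R : realType}.
Context {P : probability Omega R}.

Lemma measurable_coin (theta : {RV P >-> bool}) c :
  measurable (theta @^-1` [set c]).
Proof. by rewrite -[X in measurable X]setTI; exact: measurable_funP. Qed.

Lemma measurable_index k (Y : {RV P >-> 'I_k.+1}) y :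
  measurable (Y @^-1` [set y]).
Proof. by rewrite -[X in measurable X]setTI; exact: measurable_funP. Qed.

Lemma probability_coin (theta : {RV P >-> bool}) (p : R) c :
  P (theta @^-1` [set true]) = p%:E ->
  P (theta @^-1` [set c]) = (if c then p else 1 - p)%:E.
Proof.
case: c => // theta_p.
have -> : theta @^-1` [set false] = ~` (theta @^-1` [set true]).
  by apply/seteqP; split => w /=; case: (theta w).
by rewrite probability_setC ?theta_p//; exact: measurable_coin.
Qed.

Lemma expectation_page_evals (theta : nat -> {RV P >-> bool}) (p : R) n T :
  (forall t, P (theta t @^-1` [set true]) = p%:E) ->
  ('E_P[fun w => (page_evals n (theta^~ w) T)%:R]
    = (T%:R * (n%:R * p + 2 * (1 - p)))%:E)%E.
Proof.
move=> theta_p; rewrite unlock /page_evals.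
pose cost t w : R := (if theta t w then n else 2)%:R.
have costE t c w : (setT `&` theta t @^-1` [set c]) w ->
  cost t w = (if c then n else 2)%:R by rewrite /cost => -[_ /= ->].
have mcost t c :
    measurable_fun (setT `&` theta t @^-1` [set c]) (cost t).
  apply: (eq_measurable_fun (cst ((if c then n else 2)%:R : R))) => // w.
  by rewrite inE => /costE.
under eq_integral => w _ do rewrite natr_sum -sumEFin.
rewrite ge0_integral_sum //; last 2 first.
- move=> t; apply/measurable_EFinP.
  apply: measurable_fun_finpartition (mcost t) => //.
  exact: measurable_coin.
- by move=> t w _; rewrite lee_fin.
transitivity (\sum_(t < T) (n%:R * p + 2 * (1 - p))%:E)%E; last first.
  by rewrite sumEFin sumr_const card_ord -(mulr_natl (_ + _)).
apply: eq_bigr => t _.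
rewrite (ge0_integral_finpartition _ _ _ (measurable_coin (theta t)) _ _ _ _
  (mcost t)) //.
have intE c : (\int[P]_(w in setT `&` theta t @^-1` [set c]) (cost t w)%:E
    = ((if c then n else 2)%:R * (if c then p else 1 - p))%:E)%E.
  under eq_integral => w /[!inE] /costE -> do over.
  rewrite setTI integral_cst; last exact: measurable_coin.
  have Pc := probability_coin (theta t) p c (theta_p t).
  by rewrite [X in (_ * X)%E]Pc.
by rewrite big_bool /= !intE.
Qed.

End coin.

(** * From the random trajectory to iterates of the mean operator *)

Section page_expectation.
Context {d : measure_display} {Omega : measurableType d} {R : realType}.
Variable P : probability Omega R.
Context {X : euclideanType R} (m : nat).
Let n := m.+1.
Variables (f : 'I_n -> X -> R) (gamma p : R) (x0 g0 : X).
Variables (theta : nat -> {RV P >-> bool}) (i : nat -> {RV P >-> 'I_n}).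
Hypothesis theta_p : forall t, P (theta t @^-1` [set true]) = p%:E.
Hypothesis i_unif : forall t, uniform (i t).
Hypothesis indep : mutually_independent P (coins_indices theta i).

Let weight (b : bool) := if b then p else 1 - p.

Let coin_event (ct : nat -> bool) (ci : nat -> 'I_n) (k : nat + nat) :=
  match k with
  | inl s => theta s @^-1` [set ct s]
  | inr s => i s @^-1` [set ci s]
  end.

Let history ct ci t : set Omega :=
  [set w | forall s, (s < t)%N -> theta s w = ct s /\ i s w = ci s].

Let times t : seq (nat + nat) :=
  map inl (index_iota 0 t) ++ map inr (index_iota 0 t).

(** A finite intersection over distinct indices is the form to which mutual independence and closure
    of sigma-algebras apply. *)
Let historyE ct ci t :
  history ct ci t = \big[setI/setT]_(k <- times t) coin_event ct ci k.
Proof.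
rewrite -bigcap_seq; apply/seteqP; split => w.
  move=> h k /=; rewrite mem_cat => /orP[|] /mapP[s];
    by rewrite mem_index_iota => /= /h[? ?] ->.
move=> h s st; split.
  apply: (h (inl s)) => /=; rewrite mem_cat map_f ?orbT// mem_index_iota.
  by [].
by apply: (h (inr s)) => /=; rewrite mem_cat map_f ?orbT// mem_index_iota.
Qed.

Lemma coin_event_mem ct ci k : coins_indices theta i k (coin_event ct ci k).
Proof. by case: k => s /=; eexists; rewrite ?setTI. Qed.

Let P_theta t c : P (theta t @^-1` [set c]) = (weight c)%:E.
Proof. exact: probability_coin. Qed.

Lemma P_history ct ci t :
  P (history ct ci t) = (\prod_(0 <= s < t) (weight (ct s) * n%:R^-1))%:E.
Proof.
rewrite historyE indep.
- rewrite big_cat !big_map /= -prodEFin -big_split /=.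
  by apply: eq_bigr => s _; rewrite P_theta i_unif.
- rewrite cat_uniq !map_inj_uniq ?iota_uniq/=; last 2 first.
  + by move=> ? ? [].
  + by move=> ? ? [].
  by rewrite andbT; apply/hasPn => _ /mapP[s _ ->]; apply/mapP => -[].
- by move=> k _; exact: coin_event_mem.
Qed.

Lemma measurable_history ct ci t : measurable (history ct ci t).
Proof.
rewrite historyE; apply: bigsetI_measurable => -[s|s] _ /=.
  exact: measurable_coin.
exact: measurable_index.
Qed.

Variables (T : nat) (J : {RV P >-> 'I_T.+1}).
Hypothesis J_unif : uniform J.
Hypothesis J_indep : independent P (g_sigma_algebra_preimage J)
  <<s \bigcup_k coins_indices theta i k >>.

Lemma history_sigma ct ci t :
  <<s \bigcup_k coins_indices theta i k >> (history ct ci t).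
Proof.
rewrite historyE.
pose G := \bigcup_k coins_indices theta i k.
apply: (@bigsetI_measurable _ (g_sigma_algebraType G)) => k _.
by apply: sub_sigma_algebra; exists k => //; exact: coin_event_mem.
Qed.

Lemma P_history_J ct ci t j : P (history ct ci t `&` J @^-1` [set j])
  = (\prod_(0 <= s < t) (weight (ct s) * n%:R^-1) * T.+1%:R^-1)%:E.
Proof.
rewrite setIC J_indep ?J_unif ?P_history; last 2 first.
- by exists [set j]; rewrite ?setTI.
- exact: history_sigma.
by rewrite muleC EFinM.
Qed.

(** Induction on the number [t] of remaining steps, for all histories of length [s]. With no step
    left the iterate is constant on the event; otherwise the event is split by the draw at time [s].
    Fixing the value of [J] as well later allows the random time to be read as [j]. *)
Lemma integral_page (F : X * X -> R) (F0 : forall y, 0 <= F y) j t s ct ci :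
  let D := history ct ci s `&` J @^-1` [set j] in
  let Z w := F (page f gamma x0 g0 (theta^~ w) (i^~ w) (s + t)) in
  measurable_fun D Z /\
  (\int[P]_(w in D) (Z w)%:E
    = (\prod_(0 <= k < s) (weight (ct k) * n%:R^-1) * T.+1%:R^-1
       * iter t (page_mean m f p gamma) F (page f gamma x0 g0 ct ci s))%:E)%E.
Proof.
elim: t s ct ci => [|t IH] s ct ci D Z.
  have ZE w : D w -> Z w = F (page f gamma x0 g0 ct ci s).
    by move=> [h _]; rewrite /Z addn0 (eq_page n f gamma x0 g0 _ ct _ ci).
  split.
    apply: (eq_measurable_fun (cst (F (page f gamma x0 g0 ct ci s)))) => //.
    by move=> w /[!inE] /ZE.
  under eq_integral => w /[!inE] Dw do rewrite ZE//.
  rewrite integral_cst; last first.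
    by apply: measurableI; [exact: measurable_history|exact: measurable_index].
  have PD := P_history_J ct ci s j.
  by rewrite [X in (_ * X)%E]PD -EFinM mulrC.
pose Y w := (theta s w, i s w).
(* Overwriting entry [s] of the reference sequences makes each piece a history of length [s.+1], to
   which the induction hypothesis applies. *)
pose upd (A : Type) (c : nat -> A) (a : A) k := if k == s then a else c k.
have DY y : D `&` Y @^-1` [set y]
    = history (upd _ ct y.1) (upd _ ci y.2) s.+1 `&` J @^-1` [set j].
  apply/seteqP; split => w /=.
    move=> [[h Jw] Yw]; split=> // k; rewrite ltnS leq_eqVlt /upd -Yw.
    by have [->|_ /h] := eqVneq k s.
  move=> [h Jw]; split; last first.
    by have := h s (leqnn _); rewrite /upd eqxx /Y => -[-> ->]; case: y {h}.
  split=> // k ks; have := h k (ltnW ks).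
  by rewrite /upd (ltn_eqF ks).
have mY y : measurable (Y @^-1` [set y]).
  have -> : Y @^-1` [set y]
      = theta s @^-1` [set y.1] `&` i s @^-1` [set y.2].
    apply/seteqP; split => w /=; first by move=> <-.
    by move=> [yw1 yw2]; rewrite /Y yw1 yw2; case: y {yw1 yw2}.
  apply: measurableI; last exact: measurable_index.
  exact: measurable_coin.
have mD : measurable D.
  by apply: measurableI; [exact: measurable_history|exact: measurable_index].
have {}IH y := IH s.+1 (upd _ ct y.1) (upd _ ci y.2).
rewrite addSnnS in IH.
have mZ y : measurable_fun (D `&` Y @^-1` [set y]) Z.
  by rewrite DY; have [] := IH y.
split; first exact: measurable_fun_finpartition mZ.
rewrite (ge0_integral_finpartition _ _ _ mY _ mD _ _ mZ); last first.
  by move=> w; exact: F0.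
set z := page f gamma x0 g0 ct ci s.
set W := \prod_(0 <= k < s) _; pose H := iter t (page_mean m f p gamma) F.
(* Each piece has the mass of the whole event times [weight y.1 / n], so that summing over the draws
   is one application of [page_mean]. *)
transitivity (\sum_(y : bool * 'I_n) (W / T.+1%:R / n%:R
    * (weight y.1 * H (page_step f gamma y.1 y.2 z)))%:E)%E.
  apply: eq_bigr => y _.
  have updE s' :
      (s' < s)%N -> upd _ ct y.1 s' = ct s' /\ upd _ ci y.2 s' = ci s'.
    by move=> s's; rewrite /upd (ltn_eqF s's).
  have pageE : page f gamma x0 g0 (upd _ ct y.1) (upd _ ci y.2) s.+1
      = page_step f gamma y.1 y.2 z.
    by rewrite /= (eq_page n f gamma x0 g0 _ ct _ ci s updE) /upd eqxx.
  have WE : \prod_(0 <= k < s.+1) (weight (upd _ ct y.1 k) * n%:R^-1)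
      = W * (weight y.1 * n%:R^-1).
    rewrite big_nat_recr //= {2}/upd eqxx; congr (_ * _).
    by apply: eq_big_nat => k /andP[_ /updE[-> _]].
  have := (IH y).2; rewrite pageE WE -DY => ->; congr (_%:E).
  by rewrite -/H; ring.
rewrite sumEFin -mulr_sumr; congr (_%:E) => /=.
rewrite -(pair_bigA _ (fun b k => weight b * H (page_step f gamma b k z))) /=.
rewrite -/H /page_mean big_bool /= -[LHS]mulrA; congr (_ * (_ * _)).
by rewrite big_split.
Qed.

Lemma expectation_page (F : X * X -> R) : (forall y, 0 <= F y) ->
  ('E_P[fun w => F (page f gamma x0 g0 (theta^~ w) (i^~ w) (J w))]
    = (T.+1%:R^-1
       * \sum_(t < T.+1) iter t (page_mean m f p gamma) F (x0, g0))%:E)%E.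
Proof.
move=> F0; rewrite unlock.
pose Z t w := F (page f gamma x0 g0 (theta^~ w) (i^~ w) t).
(* The reference sequences are arbitrary: a history of length 0 is the whole space. *)
have IP (j : 'I_T.+1) := integral_page F F0 j j 0 (fun=> false) (fun=> ord0).
have hist0 : history (fun=> false) (fun=> ord0) 0 = setT.
  by apply/seteqP; split => // w _ s.
rewrite hist0 /= in IP.
have mZ (j : 'I_T.+1) :
    measurable_fun (setT `&` J @^-1` [set j]) (fun w => Z (J w) w).
  have [+ _] := IP j; apply: eq_measurable_fun => w.
  by rewrite inE => -[_ /= ->].
rewrite (ge0_integral_finpartition _ _ _ (measurable_index _ J) _ _ _ _ mZ) //;
  last by move=> w; exact: F0.
rewrite mulr_sumr -sumEFin; apply: eq_bigr => j _.
have := (IP j).2; rewrite big_geq// mul1r => <-.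
by apply: eq_integral => w; rewrite inE => -[_ /= ->].
Qed.

End page_expectation.

(** * Inequalities for the stepsize *)

Section stepsize.
Context {R : realType}.
Variables (eta L tau p : R).
Hypotheses (eta0 : 0 < eta) (eta1 : eta < 1) (L0 : 0 < L).
Hypotheses (tau0 : 0 <= tau) (tauL : tau <= L) (p0 : 0 < p) (p1 : p <= 1).

Let s := Num.sqrt (2 * tau / (L + tau)) * Num.sqrt ((1 - p) / p).
Let gamma := eta / (L * (1 + s)).

Let s0 : 0 <= s. Proof. by rewrite mulr_ge0 ?sqrtr_ge0. Qed.

Let Ltau0 : 0 < L + tau. Proof. exact: ltr_wpDr. Qed.

Let sqr_s : s ^+ 2 * (L + tau) = 2 * tau * ((1 - p) / p).
Proof.
rewrite exprMn !sqr_sqrtr ?divr_ge0 ?mulr_ge0 ?subr_ge0 ?(ltW p0) ?(ltW Ltau0)//.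
by field; rewrite !gt_eqF.
Qed.

Lemma stepsize_gt0 : 0 < gamma.
Proof. by rewrite divr_gt0// mulr_gt0// ltr_wpDr. Qed.

Let gammaE : L * gamma * (1 + s) = eta.
Proof. by rewrite /gamma; field; rewrite !gt_eqF// ltr_wpDr. Qed.

Lemma stepsize_le_eta : L * gamma <= eta.
Proof.
rewrite -gammaE ler_peMr ?lerDl//.
by rewrite mulr_ge0// ltW// stepsize_gt0.
Qed.

(* With [z = L * gamma], the choice of [gamma] gives [z * s <= 1 - z]; after
   substituting [s], the claim reduces to [tau * (1 - 2 z + 2 z^2) <= L]. *)
Lemma stepsize_variance : (1 - p) / p * L * tau * gamma ^+ 2
  <= 1 - L * gamma + L * gamma * (gamma * (L - tau)) / 2.
Proof.
have L2 : 0 < 2 * L by rewrite mulr_gt0.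
rewrite -(ler_pM2l L2); move: gammaE stepsize_le_eta.
have z0 : 0 < L * gamma by rewrite mulr_gt0// stepsize_gt0.
have -> : 2 * L * ((1 - p) / p * L * tau * gamma ^+ 2)
    = (L * gamma * s) ^+ 2 * (L + tau).
  rewrite [RHS](_ : _ = (L * gamma) ^+ 2 * (s ^+ 2 * (L + tau))); last by ring.
  by rewrite sqr_s; ring.
have -> : 2 * L * (1 - L * gamma + L * gamma * (gamma * (L - tau)) / 2)
    = 2 * L * (1 - L * gamma) + (L * gamma) ^+ 2 * (L - tau) by field.
move: (L * gamma) s z0 s0 => z r z0 r0 zr zeta.
have zr0 : 0 <= z * r by rewrite mulr_ge0// ltW.
have zr1 : z * r <= 1 - z.
  by rewrite lerBrDl -[X in X + _]mulr1 -mulrDr zr ltW.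
have : (z * r) ^+ 2 <= (1 - z) ^+ 2 by rewrite ler_sqr ?nnegrE//; lra.
move=> /(ler_wpM2r (ltW Ltau0)) /le_trans; apply.
have : tau * (2 * z * (1 - z)) >= 0 by rewrite !mulr_ge0//; lra.
by have := tauL; lra.
Qed.

(** Since 2 tau / (L + tau) <= 1 and (1 - p) / p <= 1 / p^2, the product [s] of square roots is at
    most 1 / p, whence 1 + s <= 2 / p. *)
Lemma stepsize_inv_le : gamma^-1 <= 2 / eta * L / p.
Proof.
have sp : s <= p^-1.
  rewrite -ler_sqr ?nnegrE ?invr_ge0 ?(ltW p0)//.
  rewrite -(ler_pM2r Ltau0) sqr_s.
  have q1 : (1 - p) / p <= p^-1 ^+ 2.
    rewrite expr2 ler_pM2r ?invr_gt0//.
    apply: (@le_trans _ _ 1); first by rewrite gerBl ltW.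
    by rewrite invf_ge1.
  have : 2 * tau * ((1 - p) / p) <= 2 * tau * p^-1 ^+ 2.
    by rewrite ler_wpM2l// mulr_ge0.
  have := mulr_ge0 tau0 (sqr_ge0 p^-1).
  have : 0 <= (L - tau) * p^-1 ^+ 2 by rewrite mulr_ge0 ?sqr_ge0 ?subr_ge0.
  by have := tauL; lra.
have p1' : 1 <= p^-1 by rewrite invf_ge1.
rewrite /gamma invf_div ler_pdivrMr//.
have -> : 2 / eta * L / p * eta = L * (2 * p^-1).
  by field; rewrite !gt_eqF.
by rewrite ler_pM2l//; lra.
Qed.

End stepsize.

(** * Convergence rate and gradient complexity *)

Theorem corollary2p2 (R : realType) (eta C0 : R) :
  0 < eta < 1 -> 0 <= C0 ->
  exists C1 C2 C3 : R, [/\ 0 < C1, 0 < C2 & 0 < C3] /\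
  forall (X : euclideanType R) (m : nat) (n := m.+1) (L tau p : R)
    (f : 'I_n -> X -> R) (x0 g0 : X)
    (favg := average f)
    (fstar := inf (range favg))
    (gamma := eta / (L * (1 + Num.sqrt (2 * tau / (L + tau))
                              * Num.sqrt ((1 - p) / p))))
    (d : measure_display) (Omega : measurableType d) (P : probability Omega R)
    (theta : nat -> {RV P >-> bool}) (i : nat -> {RV P >-> 'I_n})
    (J : forall T : nat, {RV P >-> 'I_T.+1})
    (x := fun (t : nat) (w : Omega) =>
       (page f gamma x0 g0 (fun s => theta s w) (fun s => i s w) t).1)
    (xtilde := fun (T : nat) (w : Omega) => x (J T w) w)
    (Delta0 := favg x0 - fstar)
    (a := 1 / 2)
    (b := gamma * (L - tau) / (4 - 2 * gamma * (L - tau)))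
    (Psi0 := Delta0 - b * gamma * `|grad favg x0| ^+ 2
             + a * gamma / p * `|g0 - grad favg x0| ^+ 2
             + b * gamma / p * `|g0| ^+ 2),
  0 < L -> 0 <= tau <= L -> 0 < p <= 1 ->
  (forall k, smooth L (f k)) ->
  (forall k, weakly_convex tau (f k)) ->
  has_lbound (range favg) ->
  `|g0| ^+ 2 <= C0 * `|grad favg x0| ^+ 2 ->
  (forall t, P (theta t @^-1` [set true]) = p%:E) ->
  (forall t, uniform (i t)) ->
  mutually_independent P (coins_indices theta i) ->
  (forall T, uniform (J T)) ->
  (forall T, independent P (g_sigma_algebra_preimage (J T))
               <<s \bigcup_k coins_indices theta i k >>) ->
  (forall T : nat, (1 <= T)%N ->
     ('E_P[fun w => (`|grad favg (xtilde T w)| ^+ 2)%R]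
        <= (C1 * (Psi0 / (T%:R * gamma)))%:E)%E /\
     Psi0 / (T%:R * gamma) <= C2 * (Delta0 * L / (T%:R * p))) /\
  (n%:R^-1 <= p ->
   forall eps : R, 0 < eps ->
   exists T : nat,
     [/\ ('E_P[fun w => (`|grad favg (xtilde T w)| ^+ 2)%R] <= eps%:E)%E,
         ('E_P[fun w => ((page_evals n (fun s => theta s w) T)%:R)%R]
            = (T%:R * (n%:R * p + 2 * (1 - p)))%:E)%E
       & T%:R * (n%:R * p + 2 * (1 - p)) <= C3 * (Delta0 * L * n%:R * eps^-1)]).
Proof.
move=> /andP[eta0 eta1] C00.
(* [C1] inverts the lower bound (1 - eta) / 2 of 1/2 - b. In units of Delta0 L / p, the parts of
   [C2] are 2 / eta for Delta0 / gamma, 2 + 2 C0 for the estimator error and C0 for the last term of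
   [Psi0]. *)
pose C1 := 2 / (1 - eta); pose C2 := 2 / eta + 2 + 3 * C0.
have C10 : 0 < C1 by rewrite divr_gt0// subr_gt0.
have C20 : 0 < C2.
  have : 0 < 2 / eta by rewrite divr_gt0.
  by rewrite /C2; lra.
have C30 : 0 < 3 * (C1 * C2 + 2).
  by have := mulr_gt0 C10 C20; lra.
exists C1, C2, (3 * (C1 * C2 + 2)); split=> //.
move=> X m n L tau p f x0 g0 favg fstar gamma d Omega P theta i J x xtilde.
move=> Delta0 a b Psi0 L0 /andP[tau0 tauL] /andP[p0 p1] fL ftau f_lb g0_le.
move=> theta_p i_unif indep J_unif J_indep.
have gamma0 : 0 < gamma by exact: stepsize_gt0.
have Lgamma : L * gamma <= eta by exact: stepsize_le_eta.
have gamma_le : (1 - p) / p * L * tau * gamma ^+ 2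
    <= 1 - L * gamma + L * gamma * (gamma * (L - tau)) / 2.
  by exact: stepsize_variance.
have gamma_inv : gamma^-1 <= 2 / eta * L / p by exact: stepsize_inv_le.
have y0 : 0 <= gamma * (L - tau) by rewrite mulr_ge0 ?subr_ge0// ltW.
have y1 : gamma * (L - tau) <= eta.
  by apply: le_trans Lgamma; rewrite mulrBr mulrC gerBl mulr_ge0// ltW.
have bE : b * (2 - gamma * (L - tau)) = gamma * (L - tau) / 2.
  rewrite /b (_ : 4 - _ = 2 * (2 - gamma * (L - tau))); last by ring.
  by field; apply: lt0r_neq0; lra.
clearbody gamma.
have b0 : 0 <= b.
  by rewrite /b divr_ge0// -?mulrA; lra.
have b1 : 1 / 2 - b >= (1 - eta) / 2.
  have : b * 1 <= b * (2 - gamma * (L - tau)) by rewrite ler_wpM2l//; lra.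
  by rewrite bE mulr1; lra.
have G_le := average_grad_le m f L L0 fL f_lb.
have D_ge0 : 0 <= Delta0.
  by rewrite subr_ge0; apply: ge_inf => //; exists x0.
have p01 : 0 <= p <= 1 by rewrite ltW.
pose V := page_lyapunov m f L tau p gamma.
have V0 y : 0 <= V y.
  apply: page_lyapunov_ge0 => //; first by lra.
  by rewrite -/b b0 /=; lra.
have VE : V (x0, g0) = Psi0 by [].
have Psi_ge0 : 0 <= Psi0 by rewrite -VE.
pose G (y : X * X) : R := `|grad favg y.1| ^+ 2.
have EG T : 'E_P[fun w => (`|grad favg (xtilde T w)| ^+ 2)%R]%E
    = (T.+1%:R^-1 * \sum_(t < T.+1)
        iter t (page_mean m f p gamma) G (x0, g0))%:E.
  rewrite -(expectation_page P m f gamma p x0 g0 theta i theta_p i_unif indep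
    T (J T) (J_unif T) (J_indep T) G)// => y; exact: sqr_ge0.
have bound T : (1 <= T)%N ->
  ('E_P[fun w => (`|grad favg (xtilde T w)| ^+ 2)%R]
    <= (C1 * (Psi0 / (T%:R * gamma)))%:E)%E.
  move=> T1; rewrite EG lee_fin.
  have T0 : 0 < T%:R :> R by rewrite ltr0n.
  have := iter_page_mean_sum_le m f p gamma (gamma * (1 / 2 - b)) G V
    T.+1 (x0, g0) p01 V0.
  rewrite VE => /(_ (page_lyapunov_descent _ _ _ _ _ _ L0 tau0 p0 p1 gamma0
    fL ftau _ gamma_le)).
  set S := \sum_(t < T.+1) _ => S_le.
  have k0 : 0 < (1 - eta) / 2 by rewrite divr_gt0// subr_gt0.
  have S_le' : S <= C1 * Psi0 / gamma.
    have kb : 0 < gamma * (1 / 2 - b) by rewrite mulr_gt0// (lt_le_trans k0).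
    apply: (@le_trans _ _ (Psi0 / (gamma * (1 / 2 - b)))).
      rewrite ler_pdivlMr// mulrC; apply: S_le; lra.
    rewrite invfM mulrA mulrAC ler_pM2r ?invr_gt0// mulrC ler_wpM2r//.
    rewrite (_ : C1 = ((1 - eta) / 2)^-1); last by rewrite invf_div.
    by rewrite lef_pV2 ?posrE// (lt_le_trans k0).
  apply: (@le_trans _ _ (T.+1%:R^-1 * (C1 * Psi0 / gamma))).
    by rewrite ler_pM2l// invr_gt0.
  have -> : C1 * (Psi0 / (T%:R * gamma)) = T%:R^-1 * (C1 * Psi0 / gamma).
    by field; rewrite !gt_eqF.
  (* The average has T + 1 terms; as [Psi0] is nonnegative, replacing 1 / (T + 1) by 1 / T only
     weakens the bound. *)
  apply: ler_wpM2r.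
    by apply: divr_ge0 (ltW gamma0); apply: mulr_ge0 (ltW C10) Psi_ge0.
  by rewrite lef_pV2 ?posrE// ler_nat.
have Psi_le T : (1 <= T)%N ->
  Psi0 / (T%:R * gamma) <= C2 * (Delta0 * L / (T%:R * p)).
  move=> T1; have T0 : 0 < T%:R :> R by rewrite ltr0n.
  have -> : C2 * (Delta0 * L / (T%:R * p)) = C2 * Delta0 * L / p / T%:R.
    by field; rewrite !gt_eqF.
  rewrite invfM mulrA mulrAC ler_pM2r ?invr_gt0//.
  have -> : Psi0 / gamma = Delta0 / gamma - b * `|grad favg x0| ^+ 2
      + 1 / 2 / p * `|g0 - grad favg x0| ^+ 2 + b / p * `|g0| ^+ 2.
    by rewrite /Psi0 /a; field; rewrite !gt_eqF.
  have : `|g0 - grad favg x0| ^+ 2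
      <= 2 * `|g0| ^+ 2 + 2 * `|grad favg x0| ^+ 2.
    have := sqr_ge0 `|g0 + grad favg x0|.
    move: (grad favg x0) => u.
    rewrite -!inner_normE !innerDl !innerDr !innerNl !innerNr (inner_sym u).
    by lra.
  have ip0 : 0 < p^-1 by rewrite invr_gt0.
  have := G_le x0; rewrite -/favg -/fstar -/Delta0.
  move: (`|g0 - _| ^+ 2 : R) (sqr_ge0 `|grad favg x0|) g0_le (sqr_ge0 `|g0|).
  move: (`|grad favg x0| ^+ 2 : R) (`|g0| ^+ 2 : R) => M h E M0 hM h0 ML EM.
  have e1 : Delta0 / gamma <= Delta0 * (2 / eta * L / p) by rewrite ler_wpM2l.
  have e2 : 0 <= b * M by rewrite mulr_ge0.
  have e3 : C0 * M <= C0 * (2 * L * Delta0) by rewrite ler_wpM2l.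
  have e4 : p^-1 * E <= p^-1 * (2 * (C0 + 1) * (2 * L * Delta0)).
    by rewrite ler_pM2l//; lra.
  have e5 : p^-1 * h <= p^-1 * (C0 * (2 * L * Delta0)).
    by rewrite ler_pM2l//; lra.
  have e6 : b * (p^-1 * h) <= 1 / 2 * (p^-1 * h).
    by rewrite ler_wpM2r ?mulr_ge0// ?ltW//; lra.
  rewrite /C2; lra.
split=> [T T1|np eps eps0]; first by split; [exact: bound|exact: Psi_le].
have evals T := expectation_page_evals theta p n T theta_p.
(* For large [eps] the initial point already qualifies, with T = 0. Otherwise 1 < 2 L Delta0 / eps,
   which later pays for rounding up the number of iterations. *)
have [eps_le|eps_gt] := leP (2 * L * Delta0) eps.
  exists 0%N; split; last 2 first.
  - exact: evals.
  - rewrite mul0r; apply: mulr_ge0 (ltW C30) _; apply: divr_ge0 (ltW eps0).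
    by apply: mulr_ge0 => //; apply: mulr_ge0 D_ge0 (ltW L0).
  rewrite EG lee_fin invr1 mul1r big_ord1.
  exact: le_trans (G_le x0) eps_le.
(* At T = M the two rate estimates together would give exactly [eps]; the truncation plus one lies
   above [M] and is positive. *)
pose M := C1 * C2 * (Delta0 * L / p) / eps.
have M0 : 0 <= M.
  apply: divr_ge0 (ltW eps0); apply: mulr_ge0; first by rewrite ltW// mulr_gt0.
  by apply: divr_ge0 (ltW p0); apply: mulr_ge0 D_ge0 (ltW L0).
have /andP[TM MT] := truncn_itv M0.
exists (Num.truncn M).+1; split; [|exact: evals|].
  apply: (le_trans (bound _ _)) => //; rewrite lee_fin.
  apply: (le_trans (ler_wpM2l (ltW C10) (Psi_le _ _))) => //.
  have -> : C1 * (C2 * (Delta0 * L / ((Num.truncn M).+1%:R * p)))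
      = M * eps / (Num.truncn M).+1%:R.
    by rewrite /M; field; rewrite !gt_eqF.
  by rewrite ler_pdivrMr ?ltr0n// mulrC ler_pM2l// ltW.
have n0 : 0 < n%:R :> R by rewrite ltr0n.
have np1 : 1 <= n%:R * p by rewrite -(ler_pM2l n0) divff ?gt_eqF in np.
(* From n p >= 1, the mean cost n p + 2 (1 - p) of a step is at most 3 n p: this is the factor 3 of
   the last constant, whose summand 2 covers the extra iteration. *)
apply: (@le_trans _ _ ((M + 1) * (3 * (n%:R * p)))).
  apply: ler_pM; first exact: ler0n.
  - by move: (n%:R * p : R) np1 => N N1; lra.
  - by rewrite -natr1 lerD2r.
  - by move: (n%:R * p : R) np1 => N N1; lra.
have -> : (M + 1) * (3 * (n%:R * p))
    = 3 * (C1 * C2) * (Delta0 * L * n%:R / eps) + 3 * n%:R * p.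
  by rewrite /M; field; rewrite !gt_eqF.
have : p <= 2 * (Delta0 * L / eps).
  apply: (le_trans p1); rewrite mulrA ler_pdivlMr// mul1r.
  by rewrite (mulrC Delta0) mulrA ltW.
move=> /(ler_wpM2l (ltW n0)) {np np1 n0 evals}.
have -> : n%:R * (2 * (Delta0 * L / eps)) = 2 * (Delta0 * L * n%:R / eps).
  by ring.
move: (Delta0 * L * n%:R / eps) (n%:R : R) => K N; lra.
Qed.
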